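(* Let $\mathfrak m$ be an uncountable cardinal with $\sup\{\mathfrak m^{\mathfrak n}:\mathfrak n<\mathfrak m\}=\mathfrak m$. If $G$ is a topological subgroup of $\mathrm{Iso}(\mathbb U_{\mathfrak m})$ of density $<\mathfrak m$ having property (OB), then $G$ is FSIN.
   Context: $\mathbb U_{\mathfrak m}$ is the Urysohn–Katětov space of weight $\mathfrak m$: the complete metric space of density $\mathfrak m$ containing an isometric copy of every metric space of weight $\le\mathfrak m$ and $\mathfrak m$-homogeneous (every isometry between subsets of cardinality $<\mathfrak m$ extends to an isometry of the whole space); $\mathrm{Iso}(\mathbb U_{\mathfrak m})$ is its isometry group with the topology of pointwise convergence. A topological group has property (OB) if every continuous left-invariant pseudometric on it is bounded. A real function $f$ on $G$ is left (resp. right) uniformly continuous if for each $\varepsilon>0$ there is a neighbourhood $V$ of $e$ with $x^{-1}y\in V$ (resp. $xy^{-1}\in V$) implying $|f(x)-f(y)|<\varepsilon$. $G$ is FSIN if the real-valued left uniformly continuous functions on $G$ are exactly the right uniformly continuous ones. *)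

(* Defs.v *)
From Stdlib Require Import Reals List.
Open Scope R_scope.

Definition card_le (A B : Type) : Prop :=
  exists f : A -> B, forall a b, f a = f b -> a = b.
Definition card_lt (A B : Type) : Prop := card_le A B /\ ~ card_le B A.

Definition is_metric {X : Type} (d : X -> X -> R) : Prop :=
  (forall x y, 0 <= d x y) /\
  (forall x y, d x y = 0 <-> x = y) /\
  (forall x y, d x y = d y x) /\
  (forall x y z, d x z <= d x y + d y z).

Definition is_open {X : Type} (d : X -> X -> R) (U : X -> Prop) : Prop :=
  forall x, U x -> exists r, 0 < r /\ forall y, d x y < r -> U y.

Definition weight_le {X : Type} (d : X -> X -> R) (M : Type) : Prop :=
  exists B : M -> X -> Prop,
    (forall i, is_open d (B i)) /\
    (forall U, is_open d U -> forall x, U x ->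
       exists i, B i x /\ forall y, B i y -> U y).

Definition dense_in {X : Type} (d : X -> X -> R) (D : X -> Prop) : Prop :=
  forall x eps, 0 < eps -> exists y, D y /\ d x y < eps.

Definition density_eq {X : Type} (d : X -> X -> R) (M : Type) : Prop :=
  (exists D : X -> Prop, dense_in d D /\ card_le {x | D x} M) /\
  (forall D : X -> Prop, dense_in d D -> card_le M {x | D x}).

Definition complete {X : Type} (d : X -> X -> R) : Prop :=
  forall u : nat -> X,
    (forall eps, 0 < eps -> exists N, forall n m, (N <= n)%nat -> (N <= m)%nat ->
        d (u n) (u m) < eps) ->
    exists l, forall eps, 0 < eps -> exists N, forall n, (N <= n)%nat -> d (u n) l < eps.

Definition is_Urysohn_Katetov {X : Type} (d : X -> X -> R) (M : Type) : Prop :=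
  is_metric d /\ complete d /\ density_eq d M /\
  (forall (Y : Type) (dY : Y -> Y -> R), is_metric dY -> weight_le dY M ->
     exists e : Y -> X, forall a b, d (e a) (e b) = dY a b) /\
  (forall (A B : X -> Prop) (phi : X -> X),
     card_lt {x | A x} M ->
     (forall a, A a -> B (phi a)) ->
     (forall b, B b -> exists a, A a /\ phi a = b) ->
     (forall a a', A a -> A a' -> d (phi a) (phi a') = d a a') ->
     exists psi : X -> X,
       (forall x y, d (psi x) (psi y) = d x y) /\
       (forall y, exists x, psi x = y) /\
       (forall a, A a -> psi a = phi a)).

Definition is_isometry_of {X : Type} (d : X -> X -> R) (g : X -> X) : Prop :=
  (forall x y, d (g x) (g y) = d x y) /\ (forall y, exists x, g x = y).

Definition is_subgroup_Iso {X : Type} (d : X -> X -> R) (G : (X -> X) -> Prop) : Prop :=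
  (forall g, G g -> is_isometry_of d g) /\
  G (fun x => x) /\
  (forall g h, G g -> G h -> G (fun x => g (h x))) /\
  (forall g, G g -> exists h, G h /\ (forall x, g (h x) = x) /\ (forall x, h (g x) = x)).

(* basic neighbourhood of g in the topology of pointwise convergence:
   h is (F,delta)-close to g *)
Definition pw_close {X : Type} (d : X -> X -> R) (F : list X) (delta : R)
  (g h : X -> X) : Prop :=
  forall x, In x F -> d (g x) (h x) < delta.

Definition density_lt_group {X : Type} (d : X -> X -> R) (G : (X -> X) -> Prop)
  (M : Type) : Prop :=
  exists D : (X -> X) -> Prop,
    (forall g, D g -> G g) /\ card_lt {g | D g} M /\
    (forall g F delta, G g -> 0 < delta -> exists h, D h /\ pw_close d F delta g h).

Definition cont_left_inv_pseudometric {X : Type} (d : X -> X -> R)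
  (G : (X -> X) -> Prop) (p : (X -> X) -> (X -> X) -> R) : Prop :=
  (forall g, G g -> p g g = 0) /\
  (forall g h, G g -> G h -> 0 <= p g h) /\
  (forall g h, G g -> G h -> p g h = p h g) /\
  (forall g h k, G g -> G h -> G k -> p g k <= p g h + p h k) /\
  (forall g h k, G g -> G h -> G k ->
     p (fun x => g (h x)) (fun x => g (k x)) = p h k) /\
  (forall g h eps, G g -> G h -> 0 < eps ->
     exists F delta, 0 < delta /\
       forall g' h', G g' -> G h' -> pw_close d F delta g g' -> pw_close d F delta h h' ->
         Rabs (p g' h' - p g h) < eps).

Definition property_OB {X : Type} (d : X -> X -> R) (G : (X -> X) -> Prop) : Prop :=
  forall p, cont_left_inv_pseudometric d G p ->
    exists C, forall g h, G g -> G h -> p g h <= C.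

(* left uniform continuity: x^{-1} y in V implies |f x - f y| < eps,
   where z = x^{-1} y is characterized by x o z = y *)
Definition left_unif_cont {X : Type} (d : X -> X -> R) (G : (X -> X) -> Prop)
  (f : (X -> X) -> R) : Prop :=
  forall eps, 0 < eps -> exists F delta, 0 < delta /\
    forall x y z, G x -> G y -> G z -> (forall a, x (z a) = y a) ->
      pw_close d F delta (fun a => a) z -> Rabs (f x - f y) < eps.

(* right uniform continuity: x y^{-1} in V, where z = x y^{-1} satisfies z o y = x *)
Definition right_unif_cont {X : Type} (d : X -> X -> R) (G : (X -> X) -> Prop)
  (f : (X -> X) -> R) : Prop :=
  forall eps, 0 < eps -> exists F delta, 0 < delta /\
    forall x y z, G x -> G y -> G z -> (forall a, z (y a) = x a) ->
      pw_close d F delta (fun a => a) z -> Rabs (f x - f y) < eps.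

Definition FSIN {X : Type} (d : X -> X -> R) (G : (X -> X) -> Prop) : Prop :=
  forall f : (X -> X) -> R, left_unif_cont d G f <-> right_unif_cont d G f.

(* Main.v *)
Require Import Defs.
From Stdlib Require Import Reals List.
From Stdlib Require Import Lra Classical ClassicalEpsilon ProofIrrelevance.
From mathcomp Require classical_sets.
Open Scope R_scope.

(** [G] even has small invariant neighbourhoods of the identity. Let [D] be dense
    in [G] with fewer than [M] elements and let [x] be a point. One chooses points
    [y_g] (for [g] in [D]) with [d (y_g, u) = 1 + d (g x, u)] on the orbit of [x],
    such that the orbits of different [y_g] are at distance at least 1. Property
    (OB) makes the union of these orbits bounded, so a constant plus
    [min (1, d (k y_g, y_g))] is a Katetov function of [k y_g], and some point [z]
    realises it, as it is determined by fewer than [M] values. Then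
    [d (z, h z) >= min (1, d (y_g, h y_g)) >= min (1, d (g x, h g x))] for all [g],
    so continuity at the single point [z] controls all conjugates of [h] at [x]. *)

Lemma function_choice {A B : Type} (P : A -> B -> Prop) :
  (forall a, exists b, P a b) -> exists f : A -> B, forall a, P a (f a).
Proof.
  intros H.
  exists (fun a => proj1_sig (constructive_indefinite_description _ (H a))).
  intros a. exact (proj2_sig (constructive_indefinite_description _ (H a))).
Qed.

(** * Cardinal arithmetic *)

Lemma card_le_trans {A B C : Type} : card_le A B -> card_le B C -> card_le A C.
Proof.
  intros [f Hf] [g Hg]. exists (fun a => g (f a)). auto.
Qed.

Lemma card_le_prod {A B A' B' : Type} :
  card_le A A' -> card_le B B' -> card_le (A * B) (A' * B').
Proof.
  intros [f Hf] [g Hg]. exists (fun p => (f (fst p), g (snd p))).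
  intros [a b] [a' b'] E. simpl in E. injection E as E1 E2.
  rewrite (Hf _ _ E1), (Hg _ _ E2). reflexivity.
Qed.

Lemma card_lt_le_trans {A B C : Type} : card_le A B -> card_lt B C -> card_lt A C.
Proof.
  intros AB [BC nCB]. split.
  - exact (card_le_trans AB BC).
  - intros CA. exact (nCB (card_le_trans CA AB)).
Qed.

Lemma card_le_of_surj {A B : Type} (f : A -> B) :
  (forall b, exists a, f a = b) -> card_le B A.
Proof.
  intros H. destruct (function_choice _ H) as [g Hg].
  exists g. intros b b' E. rewrite <- (Hg b), <- (Hg b'), E. reflexivity.
Qed.

Lemma card_lt_not_surj {A B : Type} (f : A -> B) :
  card_lt A B -> exists b, forall a, f a <> b.
Proof.
  intros [_ nBA]. apply NNPP. intros H. apply nBA, (card_le_of_surj f).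
  intros b. apply NNPP. intros Hb. apply H. exists b. intros a E.
  apply Hb. exists a. exact E.
Qed.

Lemma card_lt_range {I A M : Type} (f : I -> A) :
  card_lt I M -> card_lt {x | exists i, f i = x} M.
Proof.
  apply card_lt_le_trans.
  apply (card_le_of_surj
    (fun i => exist (fun x => exists i, f i = x) (f i) (ex_intro _ i eq_refl))).
  intros [x [i Hi]]. exists i. subst x. reflexivity.
Qed.

Lemma card_lt_option {A M : Type} : card_lt A M -> card_le (option A) M.
Proof.
  intros H. destruct (proj1 H) as [f Hf].
  destruct (card_lt_not_surj f H) as [m Hm].
  exists (fun o => match o with Some a => f a | None => m end).
  intros [a|] [b|] E.
  - f_equal. auto.
  - destruct (Hm _ E).
  - symmetry in E. destruct (Hm _ E).
  - reflexivity.
Qed.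

(** The cardinal hypothesis quantifies over subsets of [M] only; an arbitrary [A] is replaced by its
    image under an injection into [M]. *)
Lemma card_lt_pow {A M : Type} :
  (forall S : M -> Prop, card_lt {i | S i} M -> card_le ({i | S i} -> M) M) ->
  card_lt A M -> card_le (A -> M) M.
Proof.
  intros Hsup H. destruct (proj1 H) as [f Hf].
  eapply card_le_trans; [|exact (Hsup _ (card_lt_range f H))].
  set (r := fun s : {m | exists a, f a = m} =>
              proj1_sig (constructive_indefinite_description _ (proj2_sig s))).
  assert (Hr : forall s, f (r s) = proj1_sig s).
  { intros s. exact (proj2_sig (constructive_indefinite_description _ (proj2_sig s))). }
  exists (fun u s => u (r s)).
  intros u v E. apply FunctionalExtensionality.functional_extensionality. intros a.
  assert (Ea := f_equal (fun w => w (exist (fun m => exists a, f a = m) (f a)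
                                     (ex_intro _ a eq_refl))) E).
  simpl in Ea.
  assert (R1 := Hr (exist (fun m => exists a, f a = m) (f a) (ex_intro _ a eq_refl))).
  simpl in R1. rewrite (Hf _ _ R1) in Ea. exact Ea.
Qed.

(* [M] does not embed in [A * A]: this is Koenig's diagonal argument, applied to [M = M ^ A]. *)
Lemma card_lt_square {A M : Type} :
  card_lt A M -> card_le (A -> M) M -> card_lt (A * A) M.
Proof.
  intros H Hpow. split.
  - apply card_le_trans with (2 := Hpow).
    destruct (proj1 H) as [f Hf]. destruct (card_lt_not_surj f H) as [m Hm].
    (* The value [m] lies outside the range of [f], so the only place where the function differs
       from [m] recovers [fst p]. *)
    exists (fun p a => if excluded_middle_informative (a = fst p)
                       then f (snd p) else m).
    intros [a b] [a' b'] E. assert (E' := f_equal (fun u => u a) E). simpl in E'.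
    destruct (excluded_middle_informative (a = a)) as [_|n]; [|destruct n; auto].
    destruct (excluded_middle_informative (a = a')) as [<-|n].
    + rewrite (Hf _ _ E'). reflexivity.
    + destruct (Hm _ E').
  - intros HM. destruct (card_le_trans Hpow HM) as [j Hj].
    destruct (proj1 H) as [f _].
    set (s := fun p : A * A =>
      match excluded_middle_informative (exists u, j u = p) with
      | left e => proj1_sig (constructive_indefinite_description _ e)
      | right _ => f
      end).
    assert (Hs : forall u, s (j u) = u).
    { intros u. unfold s.
      destruct (excluded_middle_informative _) as [e|n]; [|destruct n; eauto].
      apply Hj. exact (proj2_sig (constructive_indefinite_description _ e)). }
    (* In row [a] the values to avoid are the [s (a, b) a], indexed by [A], and these cannot exhaust
       [M]. The resulting [u] differs from every [s p], against [s (j u) = u]. *)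
    destruct (function_choice (fun a m => forall b, s (a, b) a <> m)) as [u Hu].
    { intros a. exact (card_lt_not_surj (fun b => s (a, b) a) H). }
    apply (Hu (fst (j u)) (snd (j u))).
    rewrite <- surjective_pairing, Hs. reflexivity.
Qed.

Lemma uncountable_two_points {M : Type} :
  ~ card_le M nat -> exists a b : M, a <> b.
Proof.
  intros H. apply NNPP. intros n. apply H. exists (fun _ => 0%nat).
  intros a b _. apply NNPP. intros E. apply n. exists a, b. exact E.
Qed.

Lemma card_lt_bool_uncountable {M : Type} : ~ card_le M nat -> card_lt bool M.
Proof.
  intros H. destruct (uncountable_two_points H) as (a & b & ab). split.
  - exists (fun c : bool => if c then a else b).
    intros [] [] E; congruence.
  - intros HM. apply H. apply card_le_trans with (1 := HM).
    exists (fun c : bool => if c then 0%nat else 1%nat). intros [] [] E; congruence.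
Qed.

Lemma card_le_square_of_bool_pow {M : Type} :
  card_le (bool -> M) M -> card_le (M * M) M.
Proof.
  apply card_le_trans.
  exists (fun (p : M * M) (c : bool) => if c then fst p else snd p).
  intros [a b] [a' b'] E.
  assert (E1 := f_equal (fun u => u true) E).
  assert (E2 := f_equal (fun u => u false) E). simpl in E1, E2. congruence.
Qed.

(** Start from the code of [(b, b)] and repeatedly pair with [a] on the left: the first entry tells
    zero from a successor. *)
Lemma card_le_nat_of_square {M : Type} {a b : M} :
  a <> b -> card_le (M * M) M -> card_le nat M.
Proof.
  intros ab [j Hj].
  exists (nat_rect (fun _ => M) (j (b, b)) (fun _ c => j (a, c))).
  intros n. induction n as [|n IH]; intros [|m] E; simpl in E.
  - reflexivity.
  - apply Hj in E. congruence.
  - apply Hj in E. congruence.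
  - apply Hj in E. injection E as E. f_equal. exact (IH _ E).
Qed.

(** * Metric spaces *)

(** The balls of radius [/ (INR n + 1)] around all points form a base; an index outside the image of
    [j] yields the empty set. *)
Lemma weight_le_card {Y M : Type} (dY : Y -> Y -> R) :
  is_metric dY -> card_le (Y * nat) M -> weight_le dY M.
Proof.
  intros (d0 & deq & dsym & dtri) [j Hj].
  exists (fun m y => exists c n, j (c, n) = m /\ dY c y < / (INR n + 1)).
  split.
  - intros i x (c & n & E & L). exists (/ (INR n + 1) - dY c x). split; [lra|].
    intros y Hy. exists c, n. split; [exact E|]. pose proof (dtri c x y). lra.
  - intros U HU x Ux. destruct (HU x Ux) as (r & r0 & Hr).
    destruct (archimed_cor1 r r0) as (n & Hn & n0).
    assert (Hn' : / (INR n + 1) < / INR n).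
    { apply lt_0_INR in n0. apply Rinv_lt_contravar; nra. }
    exists (j (x, n)). split.
    + exists x, n. split; [reflexivity|].
      rewrite (proj2 (deq x x) eq_refl). apply Rinv_0_lt_compat.
      pose proof (pos_INR n). lra.
    + intros y (c & n' & E & L). apply Hj in E. injection E as -> ->.
      apply Hr. lra.
Qed.

(** The one-point Katetov extension of the subspace [A], with [None] as the new point. *)
Definition ext_dist {X : Type} (d : X -> X -> R) {A : X -> Prop} (phi : X -> R)
  (u v : option {x | A x}) : R :=
  match u, v with
  | Some a, Some b => d (proj1_sig a) (proj1_sig b)
  | Some a, None | None, Some a => phi (proj1_sig a)
  | None, None => 0
  end.

Lemma ext_dist_metric {X : Type} (d : X -> X -> R) (A : X -> Prop) (phi : X -> R) :
  is_metric d ->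
  (forall a, A a -> 0 < phi a) ->
  (forall a b, A a -> A b -> phi a <= phi b + d a b) ->
  (forall a b, A a -> A b -> d a b <= phi a + phi b) ->
  is_metric (ext_dist d (A := A) phi).
Proof.
  intros (d0 & deq & dsym & dtri) p0 p1 p2.
  repeat split.
  - intros [[a Ha]|] [[b Hb]|]; simpl; auto using Rlt_le. lra.
  - destruct x as [[a Ha]|], y as [[b Hb]|]; simpl; intros E; auto.
    + apply deq in E. subst b. rewrite (proof_irrelevance _ Ha Hb). reflexivity.
    + pose proof (p0 a Ha). lra.
    + pose proof (p0 b Hb). lra.
  - intros <-. destruct x as [[a Ha]|]; simpl; auto. apply deq. reflexivity.
  - intros [[a Ha]|] [[b Hb]|]; simpl; auto.
  - intros [[a Ha]|] [[b Hb]|] [[c Hc]|]; simpl; auto.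
    + pose proof (p1 a b Ha Hb). lra.
    + pose proof (p0 a Ha). lra.
    + pose proof (p1 c b Hc Hb). rewrite (dsym b c). lra.
    + pose proof (p0 b Hb). lra.
    + pose proof (p0 c Hc). lra.
    + lra.
Qed.

(** Universality embeds the one-point extension given by [phi], and homogeneity carries the embedded
    copy of [A] back onto [A]; the new point follows along. *)
Lemma Urysohn_Katetov_realize {M X : Type} (d : X -> X -> R)
  (A : X -> Prop) (phi : X -> R) :
  is_Urysohn_Katetov d M -> card_le (M * nat) M -> card_lt {x | A x} M ->
  (forall a, A a -> 0 < phi a) ->
  (forall a b, A a -> A b -> phi a <= phi b + d a b) ->
  (forall a b, A a -> A b -> d a b <= phi a + phi b) ->
  exists y, forall a, A a -> d y a = phi a.
Proof.
  intros (Hd & _ & _ & Huniv & Hhom) HM HA p0 p1 p2.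
  assert (Hm := ext_dist_metric d A phi Hd p0 p1 p2).
  destruct (Huniv _ (ext_dist d (A := A) phi) Hm) as [e He].
  { apply weight_le_card; [exact Hm|].
    refine (card_le_trans _ HM). apply card_le_prod.
    - exact (card_lt_option HA).
    - exists (fun n => n). auto. }
  destruct Hd as (_ & deq & _).
  (* Homogeneity takes a total map, so [back] inverts [e] on the copy of [A] and is unconstrained
     elsewhere. *)
  destruct (function_choice
    (fun y x => forall a, e (Some a) = y -> proj1_sig a = x)) as [back Hback].
  { intros y. destruct (classic (exists a, e (Some a) = y)) as [[a Ha]|n].
    - exists (proj1_sig a). intros b Hb. apply deq.
      change (ext_dist d phi (Some b) (Some a) = 0).
      rewrite <- He, Ha, Hb. apply deq. reflexivity.
    - exists y. intros a Ha. destruct n. eauto. }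
  destruct (Hhom (fun y => exists a, e (Some a) = y) A back) as (psi & Hiso & _ & Hpsi).
  - exact (card_lt_range (fun a => e (Some a)) HA).
  - intros _ [a <-]. rewrite <- (Hback _ a eq_refl). exact (proj2_sig a).
  - intros b Hb. exists (e (Some (exist A b Hb))). split; [eauto|].
    rewrite <- (Hback _ _ eq_refl). reflexivity.
  - intros _ _ [a <-] [b <-].
    rewrite <- (Hback _ a eq_refl), <- (Hback _ b eq_refl), He. reflexivity.
  - exists (psi (e None)). intros a Ha.
    assert (E : psi (e (Some (exist A a Ha))) = a).
    { rewrite Hpsi by eauto. rewrite <- (Hback _ _ eq_refl). reflexivity. }
    rewrite <- E at 1. rewrite Hiso, He. reflexivity.
Qed.

(** The Lipschitz condition forces equal values at indices with the same point, so [phi] descends to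
    the range of [p]. *)
Lemma Urysohn_Katetov_realize_family {M X : Type} (d : X -> X -> R)
  (I : Type) (p : I -> X) (phi : I -> R) :
  is_Urysohn_Katetov d M -> card_le (M * nat) M -> card_lt I M ->
  (forall i, 0 < phi i) ->
  (forall i j, phi i <= phi j + d (p i) (p j)) ->
  (forall i j, d (p i) (p j) <= phi i + phi j) ->
  exists y, forall i, d y (p i) = phi i.
Proof.
  intros HU HM HI p0 p1 p2.
  assert (dz : forall x, d x x = 0).
  { intros x. apply (proj1 HU). reflexivity. }
  destruct (function_choice (fun x r => forall i, p i = x -> phi i = r)) as [psi Hpsi].
  { intros x. destruct (classic (exists i, p i = x)) as [[i Hi]|n].
    - exists (phi i). intros j Hj.
      assert (H1 := p1 i j). assert (H2 := p1 j i).
      rewrite Hi, Hj, dz in H1, H2. lra.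
    - exists 0. intros i Hi. destruct n. eauto. }
  assert (E : forall i, psi (p i) = phi i).
  { intros i. symmetry. apply Hpsi. reflexivity. }
  destruct (Urysohn_Katetov_realize d (fun x => exists i, p i = x) psi
    HU HM (card_lt_range p HI)) as [y Hy].
  - intros _ [i <-]. rewrite E. apply p0.
  - intros _ _ [i <-] [j <-]. rewrite !E. apply p1.
  - intros _ _ [i <-] [j <-]. rewrite !E. apply p2.
  - exists y. intros i. rewrite Hy by eauto. apply E.
Qed.

(** * Separated families of points *)

(** Both conditions involve at most two elements at a time, so they pass to unions of chains and
    Zorn's lemma applies. Maximality takes the place of a transfinite recursion. *)
Lemma maximal_clique {T : Type} (ok : T -> Prop) (compat : T -> T -> Prop) :
  exists S : T -> Prop,
    (forall s, S s -> ok s) /\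
    (forall s t, S s -> S t -> compat s t) /\
    (forall t, ok t -> compat t t ->
       (forall s, S s -> compat s t /\ compat t s) -> S t).
Proof.
  destruct (@classical_sets.Zorn_bigcup T (fun S =>
    (forall s, S s -> ok s) /\ (forall s t, S s -> S t -> compat s t)))
    as (S & [Sok Scompat] & Smax).
  - intros F HF Ftot. split.
    + intros s [A FA As]. exact (proj1 (HF A FA) s As).
    + intros s t [A FA As] [B FB Bt].
      destruct (Ftot A B FA FB) as [AB|BA].
      * exact (proj2 (HF B FB) s t (AB s As) Bt).
      * exact (proj2 (HF A FA) s t As (BA t Bt)).
  - exists S. split; [exact Sok|]. split; [exact Scompat|].
    intros t okt ctt Ht. apply NNPP. intros nt.
    apply (Smax (fun s => S s \/ s = t)).
    + split.
      * intros s Hs. left. exact Hs.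
      * intros H. apply nt, H. right. reflexivity.
    + split.
      * intros s [Hs| ->]; auto.
      * intros s s' [Hs| ->] [Hs'| ->]; auto.
        -- exact (proj1 (Ht s Hs)).
        -- exact (proj2 (Ht s' Hs')).
Qed.

(** The distance from [g x] to [h x] is itself a continuous left-invariant pseudometric in [g] and
    [h]. *)
Lemma orbit_dist_bounded {X : Type} (d : X -> X -> R) (G : (X -> X) -> Prop) (x : X) :
  is_metric d -> (forall g, G g -> is_isometry_of d g) -> property_OB d G ->
  exists C, forall g h, G g -> G h -> d (g x) (h x) <= C.
Proof.
  intros (d0 & deq & dsym & dtri) Hiso HOB.
  apply (HOB (fun g h => d (g x) (h x))). repeat split; auto.
  - intros g _. apply deq. reflexivity.
  - intros g h k Hg _ _. apply (proj1 (Hiso g Hg)).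
  - intros g h eps _ _ e0. exists (x :: nil), (eps / 2). split; [lra|].
    intros g' h' _ _ Eg Eh.
    specialize (Eg x (or_introl eq_refl)). specialize (Eh x (or_introl eq_refl)).
    pose proof (dtri (g x) (g' x) (h x)). pose proof (dtri (g' x) (h' x) (h x)).
    pose proof (dtri (g' x) (g x) (h' x)). pose proof (dtri (g x) (h x) (h' x)).
    rewrite (dsym (g' x) (g x)) in *. rewrite (dsym (h' x) (h x)) in *.
    apply Rabs_def1; lra.
Qed.

(* [y i] is obtained by gluing, at [el i x], a point at distance 1 to all the
   orbits used so far, in the freest way. *)
Lemma separated_family {M X I : Type} (d : X -> X -> R) (G : (X -> X) -> Prop)
  (el : I -> X -> X) (x : X) :
  is_Urysohn_Katetov d M -> card_le (M * nat) M -> card_lt (I * I) M ->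
  is_subgroup_Iso d G -> (forall i, G (el i)) ->
  (forall g p eps, G g -> 0 < eps -> exists i, d (g p) (el i p) < eps) ->
  exists y : I -> X,
    (forall i h, G h -> d (y i) (h x) = 1 + d (el i x) (h x)) /\
    (forall i j h, G h -> i <> j -> 1 <= d (h (y i)) (y j)).
Proof.
  intros HU HM HI (Giso & _ & _ & Ginv) Gel Hdense.
  assert (Hd := proj1 HU). destruct Hd as (d0 & deq & dsym & dtri).
  (* A set of pairs [(i, y)] serves as a partial choice of the points; the first clause of [compat]
     makes it single-valued. *)
  set (ok := fun t : I * X =>
    forall h, G h -> d (snd t) (h x) = 1 + d (el (fst t) x) (h x)).
  set (compat := fun s t : I * X =>
    (fst s = fst t -> snd s = snd t) /\
    (fst s <> fst t -> forall h, G h -> 1 <= d (h (snd s)) (snd t))).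
  destruct (maximal_clique ok compat) as (S & Sok & Scompat & Smax).
  assert (Htot : forall i, exists y, S (i, y)).
  { intros i. apply NNPP. intros Hi.
    (* Indices without a chosen point default to [x]. As [i] is one of them, the orbit of [x] is
       treated together with the others. *)
    destruct (function_choice (fun j p => S (j, p) \/ (p = x /\ forall y, ~ S (j, y))))
      as [p Hp].
    { intros j. destruct (classic (exists y, S (j, y))) as [[y Hy]|n].
      - exists y. auto.
      - exists x. right. split; [reflexivity|]. intros y Hy. apply n. eauto. }
    destruct (Urysohn_Katetov_realize_family d (I * I)
      (fun kj => el (fst kj) (p (snd kj)))
      (fun kj => 1 + d (el i x) (el (fst kj) (p (snd kj)))) HU HM HI) as [y Hy].
    { intros kj. pose proof (d0 (el i x) (el (fst kj) (p (snd kj)))). lra. }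
    { intros kj lj.
      pose proof (dtri (el i x) (el (fst lj) (p (snd lj))) (el (fst kj) (p (snd kj)))).
      rewrite (dsym (el (fst kj) _)). lra. }
    { intros kj lj.
      pose proof (dtri (el (fst kj) (p (snd kj))) (el i x) (el (fst lj) (p (snd lj)))).
      rewrite (dsym (el i x) (el (fst kj) _)). lra. }
    (* Density of the [el k] extends the prescribed distances to whole orbits. *)
    assert (Hy' : forall j h, G h -> d y (h (p j)) = 1 + d (el i x) (h (p j))).
    { intros j h Hh. apply cond_eq. intros eps e0.
      destruct (Hdense h (p j) (eps / 2) Hh) as [k Hk]; [lra|].
      specialize (Hy (k, j)). simpl in Hy.
      pose proof (dtri y (h (p j)) (el k (p j))).
      pose proof (dtri y (el k (p j)) (h (p j))).
      pose proof (dtri (el i x) (h (p j)) (el k (p j))).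
      pose proof (dtri (el i x) (el k (p j)) (h (p j))).
      rewrite (dsym (el k (p j)) (h (p j))) in *.
      apply Rabs_def1; lra. }
    assert (px : p i = x).
    { destruct (Hp i) as [H|[H _]]; [destruct Hi; eauto|exact H]. }
    assert (far : forall s, S s -> forall h, G h -> 1 <= d y (h (snd s))).
    { intros [j y'] Hs h Hh. simpl.
      destruct (Hp j) as [H|[_ H]]; [|destruct (H _ Hs)].
      assert (E : p j = y') by exact (proj1 (Scompat _ _ H Hs) eq_refl).
      rewrite <- E.
      rewrite Hy' by exact Hh. pose proof (d0 (el i x) (h (p j))). lra. }
    assert (new : forall s, S s -> fst s <> i).
    { intros [j y'] Hs E. simpl in E. subst j. apply Hi. eauto. }
    apply Hi. exists y. apply Smax.
    - intros h Hh. simpl. assert (E := Hy' i h Hh). rewrite px in E. exact E.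
    - split; [auto|]. intros n. destruct n. reflexivity.
    - intros s Hs. split; split; simpl.
      + intros E. destruct (new s Hs E).
      + intros _ h Hh. rewrite dsym. auto.
      + intros E. destruct (new s Hs (eq_sym E)).
      + intros _ h Hh. destruct (Ginv h Hh) as (h' & Hh' & hh' & _).
        rewrite <- (hh' (snd s)), (proj1 (Giso h Hh)). auto. }
  destruct (function_choice _ Htot) as [y Hy].
  exists y. split.
  - intros i. exact (Sok _ (Hy i)).
  - intros i j h Hh ij. exact (proj2 (Scompat _ _ (Hy i) (Hy j)) ij h Hh).
Qed.

(** * Small invariant neighbourhoods *)

(* [z] realises [C / 2 + 1 + min 1 (d (k (y i)) (y i))] at [k (y i)]; on this
   family the function is 1-Lipschitz because different orbits are 1-separated. *)
Lemma conjugates_uniformly_small {M X I : Type} (d : X -> X -> R)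
  (G : (X -> X) -> Prop) (el : I -> X -> X) (x : X) :
  is_Urysohn_Katetov d M -> card_le (M * nat) M -> card_lt (I * I) M ->
  is_subgroup_Iso d G -> property_OB d G -> (forall i, G (el i)) ->
  (forall g p eps, G g -> 0 < eps -> exists i, d (g p) (el i p) < eps) ->
  exists z, forall g h, G g -> G h -> Rmin 1 (d (g x) (h (g x))) <= d z (h z).
Proof.
  intros HU HM HI HG HOB Gel Hdense.
  destruct (separated_family d G el x HU HM HI HG Gel Hdense) as (y & Hyx & Hyy).
  assert (Hd := proj1 HU).
  destruct HG as (Giso & Gid & Gmul & Ginv).
  destruct (orbit_dist_bounded d G x Hd Giso HOB) as [C HC].
  destruct Hd as (d0 & deq & dsym & dtri).
  assert (dz : forall a, d a a = 0) by (intros a; apply deq; reflexivity).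
  assert (C0 : 0 <= C).
  { specialize (HC _ _ Gid Gid). rewrite dz in HC. exact HC. }
  assert (sep : forall i j g h, G g -> G h -> i <> j -> 1 <= d (g (y i)) (h (y j))).
  { intros i j g h Hg Hh ij. destruct (Ginv h Hh) as (h' & Hh' & hh' & _).
    rewrite <- (hh' (g (y i))), (proj1 (Giso h Hh)).
    exact (Hyy i j _ (Gmul _ _ Hh' Hg) ij). }
  (* All points of the new orbits are thus at distance 1 from the orbit of [x], so two of them are
     at most [C + 2] apart; the constant [C / 2 + 1] below is half of that. *)
  assert (near : forall i g, G g -> d (g (y i)) (g (el i x)) = 1).
  { intros i g Hg. rewrite (proj1 (Giso g Hg)), (Hyx i _ (Gel i)), dz. lra. }
  destruct (Urysohn_Katetov_realize_family d (I * I)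
    (fun ki => el (fst ki) (y (snd ki)))
    (fun ki => C / 2 + 1 + Rmin 1 (d (el (fst ki) (y (snd ki))) (y (snd ki))))
    HU HM HI) as [z Hz].
  { intros [k i]. simpl. pose proof (d0 (el k (y i)) (y i)).
    unfold Rmin. destruct (Rle_dec _ _); lra. }
  { intros [k i] [l j]. simpl.
    pose proof (d0 (el k (y i)) (y i)). pose proof (d0 (el l (y j)) (y j)).
    destruct (classic (i = j)) as [<-|ij].
    - pose proof (dtri (el k (y i)) (el l (y i)) (y i)).
      pose proof (d0 (el k (y i)) (el l (y i))).
      unfold Rmin. destruct (Rle_dec _ _), (Rle_dec _ _); lra.
    - pose proof (sep i j _ _ (Gel k) (Gel l) ij).
      unfold Rmin. destruct (Rle_dec _ _), (Rle_dec _ _); lra. }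
  { intros [k i] [l j]. simpl.
    pose proof (d0 (el k (y i)) (y i)). pose proof (d0 (el l (y j)) (y j)).
    pose proof (dtri (el k (y i)) (el k (el i x)) (el l (y j))).
    pose proof (dtri (el k (el i x)) (el l (el j x)) (el l (y j))).
    pose proof (near i _ (Gel k)). pose proof (near j _ (Gel l)).
    rewrite (dsym (el l (y j)) (el l (el j x))) in *.
    pose proof (HC _ _ (Gmul _ _ (Gel k) (Gel i)) (Gmul _ _ (Gel l) (Gel j))).
    simpl in *.
    unfold Rmin. destruct (Rle_dec _ _), (Rle_dec _ _); lra. }
  assert (Hz' : forall i g, G g ->
    d z (g (y i)) = C / 2 + 1 + Rmin 1 (d (g (y i)) (y i))).
  { intros i g Hg. apply cond_eq. intros eps e0.
    destruct (Hdense g (y i) (eps / 2) Hg) as [k Hk]; [lra|].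
    specialize (Hz (k, i)). simpl in Hz.
    pose proof (dtri z (g (y i)) (el k (y i))).
    pose proof (dtri z (el k (y i)) (g (y i))).
    pose proof (dtri (g (y i)) (el k (y i)) (y i)).
    pose proof (dtri (el k (y i)) (g (y i)) (y i)).
    rewrite (dsym (el k (y i)) (g (y i))) in *.
    revert Hz. unfold Rmin. destruct (Rle_dec _ _), (Rle_dec _ _); intros;
    apply Rabs_def1; lra. }
  exists z.
  (* By [Hz'], [z] is farther from [h (y i)] than from [y i] by [Rmin 1 (d (h (y i)) (y i))], while
     [h z] is as far from [h (y i)] as [z] is from [y i]. Going from [y i] to [h (el i x)] through
     [h (y i)] ends with a leg of length 1, which cancels the 1 in [Hyx]. *)
  assert (step : forall i h, G h -> Rmin 1 (d (el i x) (h (el i x))) <= d z (h z)).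
  { intros i h Hh.
    assert (E1 := Hz' i _ Gid). assert (E2 := Hz' i h Hh). simpl in E1.
    rewrite dz in E1.
    assert (E3 : d (h z) (h (y i)) = d z (y i)) by apply (proj1 (Giso h Hh)).
    pose proof (dtri z (h z) (h (y i))).
    assert (E4 := near i h Hh). assert (E5 := Hyx i _ (Gmul _ _ Hh (Gel i))).
    simpl in E5.
    pose proof (dtri (y i) (h (y i)) (h (el i x))).
    rewrite (dsym (y i) (h (y i))) in *.
    revert E1 E2. unfold Rmin. destruct (Rle_dec 1 0); [lra|].
    destruct (Rle_dec _ _), (Rle_dec _ _); intros; lra. }
  intros g h Hg Hh. apply le_epsilon. intros eps e0.
  destruct (Hdense g x (eps / 2) Hg) as [i Hi]; [lra|].
  assert (E := step i h Hh).
  assert (E' : d (h (g x)) (h (el i x)) = d (g x) (el i x))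
    by apply (proj1 (Giso h Hh)).
  pose proof (dtri (g x) (el i x) (h (g x))).
  pose proof (dtri (el i x) (h (el i x)) (h (g x))).
  rewrite (dsym (h (el i x)) (h (g x))) in *.
  revert E. unfold Rmin. destruct (Rle_dec _ _), (Rle_dec _ _); intros; lra.
Qed.

(** As [g] is an isometry, the conclusion says that [g^-1 h g] moves each point of [F] by less than
    [eps]; this form avoids inverses. *)
Definition has_small_invariant_nbhds {X : Type} (d : X -> X -> R)
  (G : (X -> X) -> Prop) : Prop :=
  forall F eps, 0 < eps -> exists F' delta, 0 < delta /\
    forall g h, G g -> G h -> pw_close d F' delta (fun a => a) h ->
      pw_close d F eps g (fun a => h (g a)).

Lemma has_small_invariant_nbhds_of_points {X : Type} (d : X -> X -> R)
  (G : (X -> X) -> Prop) :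
  (forall x, exists z, forall g h, G g -> G h ->
     Rmin 1 (d (g x) (h (g x))) <= d z (h z)) ->
  has_small_invariant_nbhds d G.
Proof.
  intros H F eps e0. destruct (function_choice _ H) as [z Hz].
  (* Below the threshold 1 the truncated distance is the distance itself. *)
  exists (map z F), (Rmin 1 eps). split; [apply Rmin_glb_lt; lra|].
  intros g h Hg Hh Hc x Hx.
  specialize (Hc (z x) (in_map z F x Hx)). simpl in Hc.
  specialize (Hz x g h Hg Hh). revert Hc Hz.
  unfold Rmin. destruct (Rle_dec _ _), (Rle_dec _ _); intros; lra.
Qed.

(** The left and right quotients are conjugate: [y^-1 x = y^-1 (x y^-1) y] and
    [y x^-1 = x (x^-1 y) x^-1]. *)
Lemma FSIN_of_small_invariant_nbhds {X : Type} (d : X -> X -> R)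
  (G : (X -> X) -> Prop) :
  is_subgroup_Iso d G -> has_small_invariant_nbhds d G -> FSIN d G.
Proof.
  intros (Giso & _ & Gmul & Ginv) Hsin f. split.
  - intros Hf eps e0. destruct (Hf eps e0) as (F & del & del0 & HF).
    destruct (Hsin F del del0) as (F' & del' & del0' & HF').
    exists F', del'. split; [exact del0'|].
    intros x y z Hx Hy Hz E Hc. rewrite Rabs_minus_sym.
    destruct (Ginv y Hy) as (y' & Hy' & yy' & y'y).
    apply (HF y x (fun a => y' (x a)) Hy Hx (Gmul _ _ Hy' Hx)).
    + intros a. apply yy'.
    + intros a Ha. rewrite <- (proj1 (Giso y Hy)), yy', <- E.
      exact (HF' y z Hy Hz Hc a Ha).
  - intros Hf eps e0. destruct (Hf eps e0) as (F & del & del0 & HF).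
    destruct (Hsin F del del0) as (F' & del' & del0' & HF').
    exists F', del'. split; [exact del0'|].
    intros x y z Hx Hy Hz E Hc. rewrite Rabs_minus_sym.
    destruct (Ginv x Hx) as (x' & Hx' & xx' & x'x).
    apply (HF y x (fun a => y (x' a)) Hy Hx (Gmul _ _ Hy Hx')).
    + intros a. rewrite x'x. reflexivity.
    + intros a Ha. rewrite <- (xx' a) at 1. rewrite <- E, (proj1 (Giso x Hx)).
      exact (HF' x' z Hx' Hz Hc a Ha).
Qed.

Theorem theorem4p6p2 (M : Type)
  (Hunc : ~ card_le M nat)
  (Hsup : forall S : M -> Prop, card_lt {i | S i} M -> card_le ({i | S i} -> M) M)
  (X : Type) (d : X -> X -> R) (HU : is_Urysohn_Katetov d M)
  (G : (X -> X) -> Prop) (HG : is_subgroup_Iso d G)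
  (Hdens : density_lt_group d G M) (HOB : property_OB d G) :
  FSIN d G.
Proof.
  apply FSIN_of_small_invariant_nbhds; [exact HG|].
  apply has_small_invariant_nbhds_of_points. intros x.
  destruct Hdens as (D & DG & Dcard & Ddense).
  (* Two is a cardinal below [M], so [M * M] embeds in [M], and iterating the pairing embeds [nat]
     in [M]. *)
  assert (HM : card_le (M * nat) M).
  { assert (HMM := card_le_square_of_bool_pow
      (card_lt_pow Hsup (card_lt_bool_uncountable Hunc))).
    destruct (uncountable_two_points Hunc) as (a & b & ab).
    refine (card_le_trans _ HMM). apply card_le_prod.
    - exists (fun m => m). auto.
    - exact (card_le_nat_of_square ab HMM). }
  apply (conjugates_uniformly_small d G (@proj1_sig (X -> X) D) x HU HM); auto.
  - exact (card_lt_square Dcard (card_lt_pow Hsup Dcard)).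
  - intros [g Dg]. exact (DG g Dg).
  - intros g p eps Hg e0.
    destruct (Ddense g (p :: nil) eps Hg e0) as (h & Dh & Hh).
    exists (exist D h Dh). apply Hh. left. reflexivity.
Qed.
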